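(* For all integers $d_1,d_2\ge 0$, $$I_{d_1,d_2}(z_1,z_2)=\sum_{n=0}^{\min(d_1,d_2)}I_{d_1,d_2,n}(z_1,z_2),$$ where $$I_{d_1,d_2,n}(z_1,z_2)=\frac{1}{(q)_{d_1-n}(q)_{d_2-n}(q)_n}\cdot\frac{(qz_2)_\infty}{(qz_1^{-1})_{d_1-n}(qz_1^{-1}z_2^{-1})_n (q^{d_1-2n+1}z_2)_\infty(q^{-d_1+2n+1}z_2^{-1})_{d_2-n} (qz_2)_{d_1-n}(qz_2^{-1})_n}.$$
   Context: $(a)_n=\prod_{i=0}^{n-1}(1-aq^i)$, $(a)_\infty=\prod_{i\ge0}(1-aq^i)$; the quotient $(qz_2)_\infty/(q^{d_1-2n+1}z_2)_\infty$ is a rational function (a finite product or the inverse of one). For non-negative integers $d_1,d_2$, $$I_{d_1,d_2}(z_1,z_2)=\frac{(q z_1^{-1} z_2^{-1})_{d_1+d_2}}{(q)_{d_1} (q)_{d_2}(qz_1^{-1})_{d_1} (qz_2^{-1})_{d_2}(q z_1^{-1} z_2^{-1})_{d_1}(q z_1^{-1} z_2^{-1})_{d_2}}.$$ The identity is one of rational functions in $q,z_1,z_2$. *)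

(* Defs.v *)
From mathcomp Require Import all_boot all_order all_algebra.
From mathcomp Require Import mpoly.

Set Implicit Arguments.
Unset Strict Implicit.
Unset Printing Implicit Defensive.

Import GRing.Theory.
Local Open Scope ring_scope.

(* The field k(q, z_1, z_2) of rational functions in three variables. *)
Notation ratfun3 k := {fraction {mpoly k[3]}}.

Definition ratfun3_var (k : fieldType) (i : 'I_3) : ratfun3 k :=
  FracField.tofrac ('X_i : {mpoly k[3]}).

(* Division and inverses below are those of a field, with 1 / 0 = 0. When q, z1
   and z2 are the variables of [ratfun3 k], every factor occurring in a
   denominator is 1 minus a nontrivial Laurent monomial, hence is nonzero. *)
Section QSeries.
Variables (K : fieldType) (q : K).

Definition qpoch (a : K) (n : nat) : K := \prod_(i < n) (1 - a * q ^+ i).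

(* (a)_oo / (q^m a)_oo for an integer m, as a rational function: (a)_m if
   m >= 0, and the inverse of (q^m a)_{-m} if m < 0. See [qpoch_oo_ratioE]. *)
Definition qpoch_oo_ratio (a : K) (m : int) : K :=
  match m with
  | Posz n => qpoch a n
  | Negz n => (qpoch (q ^ m * a) n.+1)^-1
  end.

Lemma qpochD a m n : qpoch a (m + n) = qpoch a m * qpoch (q ^+ m * a) n.
Proof.
rewrite /qpoch big_split_ord /=; congr (_ * _); apply: eq_bigr => i _.
by rewrite exprD mulrA (mulrC a).
Qed.

(* The truncations (a)_M / (q^m a)_N with M - N = m, whose numerator and
   denominator converge to (a)_oo and (q^m a)_oo, are all equal to
   [qpoch_oo_ratio a m]. *)
Lemma qpoch_oo_ratioE a (m : int) (M N : nat) :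
    q != 0 -> M%:Z = N%:Z + m -> qpoch (q ^ m * a) N != 0 ->
  qpoch_oo_ratio a m = qpoch a M / qpoch (q ^ m * a) N.
Proof.
move=> q0; case: m => n /= eqM nz.
  have -> : M = (n + N)%N by apply/eqP; rewrite -eqz_nat eqM addrC.
  by rewrite qpochD mulfK.
have eqN : N = (n.+1 + M)%N.
  by apply/eqP; rewrite -eqz_nat PoszD eqM NegzE addrC addrNK.
have qK : q ^+ n.+1 * (q ^ Negz n * a) = a.
  by rewrite mulrA NegzE -exprnN divff ?mul1r // expf_neq0.
move: nz; rewrite eqN qpochD qK mulf_eq0 negb_or => /andP[_ nzM].
by rewrite invfM mulrCA divff // mulr1.
Qed.

Definition Id1d2 (d1 d2 : nat) (z1 z2 : K) : K :=
  qpoch (q * z1^-1 * z2^-1) (d1 + d2) /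
  (qpoch q d1 * qpoch q d2 * qpoch (q * z1^-1) d1 * qpoch (q * z2^-1) d2 *
   qpoch (q * z1^-1 * z2^-1) d1 * qpoch (q * z1^-1 * z2^-1) d2).

(* Only meant for n <= minn d1 d2, so that d1 - n and d2 - n are not truncated.
   The quotient (q z2)_oo / (q^(d1 - 2n + 1) z2)_oo is
   [qpoch_oo_ratio (q * z2) (d1 - 2n)]. *)
Definition Id1d2n (d1 d2 n : nat) (z1 z2 : K) : K :=
  1 / (qpoch q (d1 - n) * qpoch q (d2 - n) * qpoch q n) *
  (qpoch_oo_ratio (q * z2) (d1%:Z - (2 * n)%:Z) /
   (qpoch (q * z1^-1) (d1 - n) * qpoch (q * z1^-1 * z2^-1) n *
    qpoch (q ^ (- d1%:Z + (2 * n)%:Z + 1) * z2^-1) (d2 - n) *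
    qpoch (q * z2) (d1 - n) * qpoch (q * z2^-1) n)).

End QSeries.

(* Main.v *)
Require Import Defs.
From mathcomp Require Import all_boot all_order all_algebra.
From mathcomp Require Import mpoly.
From mathcomp Require Import ring zify.

Import GRing.Theory.
Local Open Scope ring_scope.

(** The identity is an instance of Rogers' sum of a terminating very-well-poised
    6phi5 series. With x = 1/z1 and y = 1/z2, the denominator factors of
    I_{d1,d2,n} that involve only q and y combine (after reflecting the
    factors 1 - q^j z2 into 1 - q^(-j) y) to the product of 1 - y q^j for j from
    n - d1 to n + d2 - d1, from which the factor with j = 2n - d1 is missing.
    This is the very-well-poised shape: putting
      a = y q^(-d1),   b = q^(-d1),   c = q^(-d1) / x,
    the summand is, up to a factor independent of n, the n-th term of
      6phi5(a, q sqrt a, - q sqrt a, b, c, q^(-d2);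
            sqrt a, - sqrt a, aq/b, aq/c, a q^(d2+1); q, a q^(d2+1) / (bc)),
    whose sum is (aq)_N (aq/(bc))_N / ((aq/b)_N (aq/c)_N) with N = d2. Since
    aq/(bc) = q^(d1+1) x y, this is I_{d1,d2}.

    [rogers_sum] is this summation, written with B = 1/b and C = 1/c. It is
    proved by induction on N by the Wilf-Zeilberger method: the two sides
    satisfy the same first-order recurrence in N, because the recurrence operator
    applied to the summand is a difference in n of [rogers_cert]
    ([rogers_cert_step]). [rogers_term_Id1d2n] matches the summands. In
    the field of rational functions all the denominators are nonzero because
    distinct monomials in q, z1, z2 are distinct ([ratfun3_monom_inj]). *)

(** * q-shifted factorials *)

Section QPochhammer.
Variables (K : fieldType) (q : K).

Lemma qpoch0 a : qpoch q a 0 = 1.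
Proof. by rewrite /qpoch big_ord0. Qed.

Lemma qpochSr a n : qpoch q a n.+1 = qpoch q a n * (1 - a * q ^+ n).
Proof. by rewrite /qpoch big_ord_recr. Qed.

Lemma qpochSl a n : qpoch q a n.+1 = (1 - a) * qpoch q (a * q) n.
Proof.
by rewrite -add1n qpochD expr1 (mulrC q) {1}/qpoch big_ord1 expr0 mulr1.
Qed.

Lemma qpoch_neq0 a n :
  (forall i, 1 - a * q ^+ i != 0) -> qpoch q a n != 0.
Proof. by move=> nz; apply/prodf_neq0 => i _. Qed.

Lemma qpoch_rev a n :
  qpoch q a n = \prod_(i < n) (1 - a * q ^+ (n - i.+1)).
Proof. by rewrite /qpoch (reindex_inj rev_ord_inj). Qed.

(** This is n(n-1) = 2 (0 + 1 + ... + (n-1)), in the exponent. *)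
Lemma prod_expr2 n : \prod_(i < n) q ^+ (2 * i) = \prod_(i < n) q ^+ n.-1.
Proof.
rewrite (eq_bigr (fun i : 'I_n => q ^+ i * q ^+ i)); last first.
  by move=> i _; rewrite mul2n -addnn exprD.
rewrite big_split /= [X in _ * X](reindex_inj rev_ord_inj) /= -big_split /=.
by apply: eq_bigr => i _; rewrite -exprD; congr (_ ^+ _); have := ltn_ord i; lia.
Qed.

(** Both sides have the same factors in opposite order. The left side is
    (c^(-1) q^(-n))_n times (c q^n)^n, in a form that avoids inverses. *)
Lemma prod_sub_expr c n :
  \prod_(i < n) (c * q ^+ n - q ^+ i)
  = \prod_(i < n) (- q ^+ i) * qpoch q (c * q) n.
Proof.
rewrite qpoch_rev -big_split /=; apply: eq_bigr => i _.
have -> : q ^+ n = q ^+ i * (q * q ^+ (n - i.+1)).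
  by rewrite -exprS -exprD; congr (_ ^+ _); have := ltn_ord i; lia.
by ring.
Qed.

(** The hypothesis says that b = 1 / (w q^(n-1)), so that the factors of one
    symbol are those of the other with their monomials inverted. *)
Lemma qpoch_reflect b w n : q != 0 -> b * w * q ^+ n = q ->
  qpoch q b n = \prod_(i < n) (- (b * q ^+ i)) * qpoch q w n.
Proof.
move=> q0 bw; rewrite (qpoch_rev w) -big_split /=; apply: eq_bigr => i _.
have bw1 : b * w * (q ^+ i * q ^+ (n - i.+1)) = 1.
  apply: (mulIf q0); rewrite mul1r -[RHS]bw -!mulrA -exprSr -exprD.
  by congr (_ * (_ * _ ^+ _)); have := ltn_ord i; lia.
by rewrite -[in LHS]bw1; ring.
Qed.

End QPochhammer.

(** * Rogers' terminating 6phi5 sum *)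

Section Rogers.
Variables (K : fieldType) (q a B C : K).

(** This is (1/B)_n (1/C)_n (- a q B C)^n q^(n(n-1)/2). The sign and
    q^(n(n-1)/2) come from the factor (q^(-N))_n of the series, the rest of which
    is the (q)_{N-n} in the denominator of [rogers_term]. *)
Definition rogers_num n : K :=
  \prod_(i < n) (- (a * q ^+ i.+1) * (B - q ^+ i) * (C - q ^+ i)).

Definition rogers_term N n : K :=
  rogers_num n * (1 - a * q ^+ (2 * n)) /
  (qpoch q q n * qpoch q q (N - n) * qpoch q (a * q ^+ n) N.+1 *
   qpoch q (a * B * q) n * qpoch q (a * C * q) n).

(** For n <= N, the multiple of [rogers_term N n] by a rational function of q^n
    and q^N that is determined by [rogers_cert_step] and by its vanishing at
    n = 0. *)
Definition rogers_cert N n : K :=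
  - ((1 - q ^+ n) * (1 - a * B * q ^+ n) * (1 - a * C * q ^+ n)) *
  q ^+ (N.+1 - n) * rogers_num n /
  (qpoch q q n * qpoch q q (N.+1 - n) * qpoch q (a * q ^+ n) N.+1 *
   qpoch q (a * B * q) n * qpoch q (a * C * q) n).

Hypotheses (nzq : forall i, 1 - q * q ^+ i != 0)
           (nza : forall i, 1 - a * q ^+ i != 0)
           (nzB : forall i, 1 - a * B * q * q ^+ i != 0)
           (nzC : forall i, 1 - a * C * q * q ^+ i != 0).

Let nza_shift n i : 1 - a * q ^+ n * q ^+ i != 0.
Proof. by rewrite -mulrA -exprD. Qed.

Lemma rogers_cert_step N n : (n <= N)%N ->
  (1 - q * q ^+ N) * (1 - a * B * q * q ^+ N) * (1 - a * C * q * q ^+ N) *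
    rogers_term N.+1 n - (1 - a * B * C * q * q ^+ N) * rogers_term N n
  = rogers_cert N n.+1 - rogers_cert N n.
Proof.
move=> nN; rewrite /rogers_term /rogers_cert subSS subSn //.
(* In terms of q^n, q^(N-n) and the symbols below, both sides become rational
   functions of independent quantities. *)
have eN : q ^+ N = q ^+ (N - n) * q ^+ n by rewrite -exprD subnK.
have eE : qpoch q (a * q ^+ n) N.+1
          = (1 - a * q ^+ n) * qpoch q (a * q ^+ n.+1) N.
  by rewrite qpochSl exprSr mulrA.
have -> : rogers_num n.+1
          = rogers_num n * (- (a * q ^+ n.+1) * (B - q ^+ n) * (C - q ^+ n)).
  by rewrite /rogers_num big_ord_recr.
rewrite [qpoch q (a * q ^+ n) N.+2]qpochSr eE.
rewrite [qpoch q (a * q ^+ n.+1) N.+1]qpochSr.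
rewrite [qpoch q q n.+1]qpochSr [qpoch q q (N - n).+1]qpochSr.
rewrite [qpoch q (a * B * q) n.+1]qpochSr [qpoch q (a * C * q) n.+1]qpochSr.
have := qpoch_neq0 _ _ _ n nzq; have := qpoch_neq0 _ _ _ (N - n) nzq.
have := qpoch_neq0 _ _ _ N (nza_shift n.+1).
have := qpoch_neq0 _ _ _ n nzB; have := qpoch_neq0 _ _ _ n nzC.
have := nzq n; have := nzq (N - n)%N; have := nza n; have := nzB n.
have := nzC n; have := nza_shift n N.+1; have := nza_shift n.+1 N.
rewrite !exprS eN mulnC exprM expr2.
move: (qpoch _ _ _) (qpoch _ _ _) (qpoch _ _ _) (qpoch _ _ _) (qpoch _ _ _).
move: (rogers_num n) (q ^+ (N - n)) (q ^+ n) => U P X E1 E2 E3 E4 E5.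
by move=> *; field; do ?[apply/andP; split].
Qed.

Theorem rogers_sum N :
  \sum_(n < N.+1) rogers_term N n
  = qpoch q (a * B * C * q) N /
    (qpoch q q N * qpoch q (a * B * q) N * qpoch q (a * C * q) N).
Proof.
elim: N => [|N IH].
  rewrite big_ord1 /rogers_term /rogers_num big_ord0 !qpochSr !qpoch0 /= muln0.
  by have := nza 0; rewrite expr0 !mulr1 !mul1r => h; rewrite divff // invr1.
set c1 := (1 - q * q ^+ N) * (1 - a * B * q * q ^+ N) * (1 - a * C * q * q ^+ N).
have nc1 : c1 != 0 by rewrite !mulf_neq0.
have tele : c1 * \sum_(n < N.+1) rogers_term N.+1 n
     - (1 - a * B * C * q * q ^+ N) * \sum_(n < N.+1) rogers_term N n
     = rogers_cert N N.+1.
  rewrite !mulr_sumr -sumrB.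
  transitivity (\sum_(0 <= n < N.+1) (rogers_cert N n.+1 - rogers_cert N n)).
    by rewrite big_mkord; apply: eq_bigr => n _; rewrite -rogers_cert_step // -ltnS.
  rewrite telescope_sumr // [rogers_cert N 0]/rogers_cert expr0 subrr.
  by rewrite !(mul0r, oppr0) addr0.
(* For n = N+1 only the first term of the recurrence is there, and it closes the
   telescoping sum. *)
have last : c1 * rogers_term N.+1 N.+1 = - rogers_cert N N.+1.
  rewrite /rogers_term /rogers_cert !subnn !qpoch0 expr0.
  rewrite [qpoch q (a * q ^+ N.+1) N.+2]qpochSr.
  have n1 := qpoch_neq0 _ _ _ N.+1 (nza_shift N.+1).
  have n2 := qpoch_neq0 _ _ _ N.+1 nzq.
  have n3 := qpoch_neq0 _ _ _ N.+1 nzB.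
  have n4 := qpoch_neq0 _ _ _ N.+1 nzC.
  have := nza_shift N.+1 N.+1.
  rewrite -mulrA -exprD addnn -mul2n => n5.
  rewrite /c1 -!mulrA -!exprS !mulrA.
  by field; do ?[apply/andP; split].
apply: (mulfI nc1); rewrite big_ord_recr mulrDr /= last.
rewrite -tele IH !qpochSr /c1 opprB addrC subrK.
have n1 := qpoch_neq0 _ _ _ N nzq.
have n2 := qpoch_neq0 _ _ _ N nzB.
have n3 := qpoch_neq0 _ _ _ N nzC.
have n4 := nzq N; have n5 := nzB N; have n6 := nzC N.
by field; do ?[apply/andP; split].
Qed.

End Rogers.

(** * The identity for multiplicatively independent q, z1, z2 *)

Section Specialization.
Variables (K : fieldType) (q z1 z2 : K).

Hypotheses (q0 : q != 0) (z10 : z1 != 0) (z20 : z2 != 0)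
  (indep : forall i j l i' j' l',
     q ^+ i * z1 ^+ j * z2 ^+ l = q ^+ i' * z1 ^+ j' * z2 ^+ l' ->
     [/\ i = i', j = j' & l = l']).

Let nzq i : 1 - q * q ^+ i != 0.
Proof.
rewrite subr_eq0; apply/eqP => e1; have := indep 0 0 0 i.+1 0 0.
by rewrite !expr0 !mulr1 exprS -e1 => /(_ erefl) [].
Qed.

Let nzx i : 1 - q * z1^-1 * q ^+ i != 0.
Proof.
rewrite subr_eq0; apply/eqP => e1; have := indep 0 1 0 i.+1 0 0.
have -> : q ^+ i.+1 = z1 by rewrite exprS -[RHS]mul1r e1 mulrAC mulfVK.
by rewrite !expr0 !expr1 !mulr1 !mul1r => /(_ erefl) [].
Qed.

Let nzxy i : 1 - q * z1^-1 * z2^-1 * q ^+ i != 0.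
Proof.
rewrite subr_eq0; apply/eqP => e1; have := indep 0 1 1 i.+1 0 0.
have -> : q ^+ i.+1 = z1 * z2.
  by rewrite exprS -[RHS]mul1r e1; field; apply/andP.
by rewrite !expr0 !expr1 !mulr1 !mul1r => /(_ erefl) [].
Qed.

Let nzy (e : int) : 1 - q ^ e * z2^-1 != 0.
Proof.
rewrite subr_eq0; apply/eqP; case: e => n; rewrite ?NegzE => e1.
  have := indep 0 0 1 n 0 0.
  have -> : q ^+ n = z2 by rewrite -[RHS]mul1r e1 mulfVK.
  by rewrite !expr0 !expr1 !mulr1 !mul1r => /(_ erefl) [].
have := indep 0 0 0 n.+1 0 1.
have -> : q ^+ n.+1 * z1 ^+ 0 * z2 ^+ 1 = 1.
  rewrite expr0 expr1 -[LHS]mulr1 {2}e1 -exprnN.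
  by field; rewrite z20 expf_neq0.
by rewrite !expr0 !mulr1 => /(_ erefl) [].
Qed.

Let nzqy i : 1 - q * z2^-1 * q ^+ i != 0.
Proof. by rewrite mulrAC -exprS (nzy (Posz i.+1)). Qed.

Let nzz2 (e : int) : 1 - q ^ e * z2 != 0.
Proof.
apply: contra (nzy (- e)); rewrite !subr_eq0 => /eqP e1.
by rewrite -invr_expz -invfM -e1 invr1.
Qed.

(** With d1 = m + n, the n-dependent part of the numerator is a quotient of
    q-shifted factorials: the powers of -1 and q in [prod_sub_expr] (used for
    B and for C) and [qpoch_reflect] cancel by [prod_expr2]. *)
Lemma rogers_num_spec (a : K) (m n : nat) :
  a * q ^+ (m + n) = z2^-1 ->
  rogers_num K q a (q ^+ (m + n)) (z1^-1 * q ^+ (m + n)) n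
    * qpoch q (q ^ (m%:Z - n%:Z) * (q * z2)) n
  = qpoch q (a * q ^+ n) n * qpoch q (q ^+ m * q) n
    * qpoch q (q ^+ m * (q * z1^-1)) n.
Proof.
move=> ea; set w := q ^ _ * _.
have reflect : qpoch q (a * q ^+ n) n
    = \prod_(i < n) (- (a * q ^+ n * q ^+ i)) * qpoch q w n.
  apply: qpoch_reflect => //.
  have ew : w * q ^+ n = q ^+ m * (q * z2).
    by rewrite /w mulrAC -[q ^+ n]/(q ^ n%:Z) -expfzDr // subrK.
  rewrite -mulrA ew mulrA -[a * _ * _]mulrA -exprD [(n + m)%N]addnC ea.
  by rewrite mulrCA mulVf ?mulr1.
rewrite reflect /rogers_num !big_split /=.
have eB : \prod_(i < n) (q ^+ (m + n) - q ^+ i)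
          = \prod_(i < n) (- q ^+ i) * qpoch q (q ^+ m * q) n.
  by rewrite -prod_sub_expr exprD.
have eC : \prod_(i < n) (z1^-1 * q ^+ (m + n) - q ^+ i)
          = \prod_(i < n) (- q ^+ i) * qpoch q (q ^+ m * (q * z1^-1)) n.
  rewrite [q * _]mulrC mulrA -prod_sub_expr exprD.
  by apply: eq_bigr => i _; rewrite mulrA [z1^-1 * _]mulrC.
have sgn : \prod_(i < n) (- (a * q ^+ i.+1)) *
             (\prod_(i < n) (- q ^+ i) * \prod_(i < n) (- q ^+ i))
           = \prod_(i < n) (- (a * q ^+ n * q ^+ i)).
  transitivity (\prod_(i < n) (- (a * q * q ^+ i)) * \prod_(i < n) q ^+ (2 * i)).
    rewrite -!big_split /=; apply: eq_bigr => i _.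
    by rewrite exprS mul2n -addnn exprD; ring.
  rewrite prod_expr2 -big_split /=; apply: eq_bigr => i _.
  have -> : q ^+ n = q * q ^+ n.-1.
    by rewrite -exprS prednK // (leq_ltn_trans _ (ltn_ord i)).
  by ring.
rewrite eB eC -sgn; ring.
Qed.

Lemma rogers_term_Id1d2n (a : K) (d1 d2 n : nat) :
  a * q ^+ d1 = z2^-1 -> (n <= d1)%N -> (n <= d2)%N ->
  Id1d2n q d1 d2 n z1 z2
  = rogers_term K q a (q ^+ d1) (z1^-1 * q ^+ d1) d2 n
    / (qpoch q q d1 * qpoch q (q * z1^-1) d1).
Proof.
move=> ea nd1 nd2; rewrite /Id1d2n /rogers_term.
move: (d1 - n)%N (subnK nd1) ea => m <- {d1 nd1} ea.
set num := rogers_num _ _ _ _ _ _.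
have eaB : a * q ^+ (m + n) * q = q * z2^-1 by rewrite ea mulrC.
have eaC : a * (z1^-1 * q ^+ (m + n)) * q = q * z1^-1 * z2^-1.
  by rewrite mulrCA ea; ring.
rewrite eaB eaC.
have ae (e : nat) : a * q ^+ e = q ^ (e%:Z - (m + n)%:Z) * z2^-1.
  by rewrite -ea mulrCA -[q ^+ (m + n)]/(q ^ (m + n)%:Z) -expfzDr // subrK.
have nza i j : 1 - a * q ^+ i * q ^+ j != 0 by rewrite -mulrA -exprD ae.
have -> : (m + n)%:Z - (2 * n)%:Z = m%:Z - n%:Z by lia.
set w := q ^ (m%:Z - n%:Z) * (q * z2).
have nzw i : 1 - w * q ^+ i != 0.
  by rewrite /w mulrA mulrAC -[_ * q * _]mulrA -exprS -[q ^+ _]/(q ^ i.+1%:Z) -expfzDr.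
have nw : qpoch q w n != 0 by apply: qpoch_neq0.
rewrite (qpoch_oo_ratioE q0 (M := m) (N := n)) //; last by rewrite addrC subrK.
rewrite -/w.
(* The product over j of 1 - y q^j splits at the missing factor j = 2n - d1. *)
have -> : qpoch q (a * q ^+ n) d2.+1
  = qpoch q (a * q ^+ n) n * (1 - a * q ^+ (2 * n)) *
    qpoch q (q ^ (- (m + n)%:Z + (2 * n)%:Z + 1) * z2^-1) (d2 - n).
  have -> : d2.+1 = (n.+1 + (d2 - n))%N by lia.
  rewrite qpochD qpochSr; congr (_ * _ * qpoch _ _ _).
    by rewrite -mulrA -exprD addnn -mul2n.
  by rewrite mulrCA -exprD ae; congr (q ^ _ * _); lia.
have := rogers_num_spec _ _ _ ea; rewrite -/w -/num => enum.
rewrite [qpoch q q (m + n)]qpochD [qpoch q (q * z1^-1) (m + n)]qpochD.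
have n1 : qpoch q (a * q ^+ n) n != 0 by apply: qpoch_neq0.
have n2 : 1 - a * q ^+ (2 * n) != 0 by rewrite ae.
have n3 : qpoch q (q ^ (- (m + n)%:Z + (2 * n)%:Z + 1) * z2^-1) (d2 - n) != 0.
  apply: qpoch_neq0 => i.
  by rewrite mulrAC -[q ^+ i]/(q ^ i%:Z) -expfzDr.
have n4 := qpoch_neq0 _ _ _ m nzq; have n5 := qpoch_neq0 _ _ _ n nzq.
have n6 := qpoch_neq0 _ _ _ (d2 - n) nzq.
have n7 := qpoch_neq0 _ _ _ m nzx.
have n8 : qpoch q (q ^+ m * q) n != 0.
  by apply: qpoch_neq0 => i; rewrite mulrAC -exprD mulrC.
have n9 : qpoch q (q ^+ m * (q * z1^-1)) n != 0.
  by apply: qpoch_neq0 => i; rewrite mulrAC -exprD mulrC.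
have n10 := qpoch_neq0 _ _ _ n nzxy; have n11 := qpoch_neq0 _ _ _ n nzqy.
have n12 : qpoch q (q * z2) m != 0.
  by apply: qpoch_neq0 => i; rewrite mulrAC -exprS (nzz2 (Posz i.+1)).
have -> : num = qpoch q (a * q ^+ n) n * qpoch q (q ^+ m * q) n
                * qpoch q (q ^+ m * (q * z1^-1)) n / qpoch q w n.
  by rewrite -enum mulfK.
by field; do ?[apply/andP; split].
Qed.

Theorem Id1d2_sum d1 d2 :
  Id1d2 q d1 d2 z1 z2
  = \sum_(0 <= n < (minn d1 d2).+1) Id1d2n q d1 d2 n z1 z2.
Proof.
pose a := q ^ (- d1%:Z) * z2^-1.
have ea : a * q ^+ d1 = z2^-1.
  by rewrite /a mulrAC -[q ^+ d1]/(q ^ d1%:Z) -expfzDr // addNr mul1r.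
set B := q ^+ d1; set C := z1^-1 * q ^+ d1.
have eaB : a * B * q = q * z2^-1 by rewrite ea mulrC.
have eaC : a * C * q = q * z1^-1 * z2^-1 by rewrite /C mulrCA ea; ring.
have eaBC : a * B * C * q = q ^+ d1 * (q * z1^-1 * z2^-1).
  by rewrite ea /C; ring.
pose c := (qpoch q q d1 * qpoch q (q * z1^-1) d1)^-1.
transitivity ((\sum_(n < d2.+1) rogers_term K q a B C d2 n) * c).
  rewrite rogers_sum ?eaB ?eaC ?eaBC //; last first.
    by move=> i; rewrite /a mulrAC -[q ^+ i]/(q ^ i%:Z) -expfzDr.
  rewrite /Id1d2 qpochD /c.
  have n1 := qpoch_neq0 _ _ _ d1 nzq; have n2 := qpoch_neq0 _ _ _ d2 nzq.
  have n3 := qpoch_neq0 _ _ _ d1 nzx; have n4 := qpoch_neq0 _ _ _ d2 nzqy.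
  have n5 := qpoch_neq0 _ _ _ d1 nzxy; have n6 := qpoch_neq0 _ _ _ d2 nzxy.
  by field; do ?[apply/andP; split].
rewrite mulr_suml -(big_mkord xpredT (fun n => rogers_term K q a B C d2 n * c)).
rewrite (big_cat_nat (n := (minn d1 d2).+1)) ?ltnS ?geq_minr //=.
(* For n > d1 the factor B - q^d1 = 0 occurs in the numerator. *)
rewrite [X in _ + X]big_nat [X in _ + X]big1 => [|n /andP[ltn led2]]; last first.
  have ltd1 : (d1 < n)%N by move: ltn led2; rewrite gtn_min ltnS; lia.
  rewrite /rogers_term /rogers_num (bigD1 (Ordinal ltd1)) //=.
  by rewrite subrr mulr0 !mul0r.
rewrite addr0 !big_nat; apply: eq_bigr => n /andP[_].
rewrite ltnS leq_min => /andP[nd1 nd2].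
by rewrite (rogers_term_Id1d2n _ _ _ _ ea).
Qed.

End Specialization.

(** * Monomials in the field of rational functions *)

Section RationalFunctions.
Variable k : fieldType.

Definition ratfun3_monom (i j l : nat) : ratfun3 k :=
  ratfun3_var k (@Ordinal 3 0 isT) ^+ i * ratfun3_var k (@Ordinal 3 1 isT) ^+ j *
  ratfun3_var k (@Ordinal 3 2 isT) ^+ l.

Lemma ratfun3_monom_inj i j l i' j' l' :
  ratfun3_monom i j l = ratfun3_monom i' j' l' -> [/\ i = i', j = j' & l = l'].
Proof.
rewrite /ratfun3_monom /ratfun3_var -!tofracXn -!tofracM => /eqP.
rewrite tofrac_eq !mpolyXn -!mpolyXD => /eqP/(congr1 (mcoeff _)).
move=> /(_ (U_(@Ordinal 3 0 isT) *+ i + U_(@Ordinal 3 1 isT) *+ j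
            + U_(@Ordinal 3 2 isT) *+ l)%MM).
rewrite !mcoeffX eqxx; case: eqP => [/mnmP e _|_ /eqP]; last by rewrite oner_eq0.
have := e (@Ordinal 3 0 isT); have := e (@Ordinal 3 1 isT).
have := e (@Ordinal 3 2 isT).
rewrite !mnmDE !mulmnE !mnm1E /= => *.
by split; lia.
Qed.

End RationalFunctions.

Theorem proposition7p11 (k : fieldType) (d1 d2 : nat) :
  let q  : ratfun3 k := ratfun3_var k (@Ordinal 3 0 isT) in
  let z1 : ratfun3 k := ratfun3_var k (@Ordinal 3 1 isT) in
  let z2 : ratfun3 k := ratfun3_var k (@Ordinal 3 2 isT) in
  Id1d2 q d1 d2 z1 z2
    = \sum_(0 <= n < (minn d1 d2).+1) Id1d2n q d1 d2 n z1 z2.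
Proof.
move=> q z1 z2.
have var0 i : ratfun3_var k i != 0.
  by rewrite tofrac_eq0; apply/eqP => /(congr1 (mcoeff U_(i)%MM));
     rewrite mcoeffXU eqxx mcoeff0 => /eqP; rewrite oner_eq0.
exact: (Id1d2_sum _ q z1 z2 (var0 _) (var0 _) (var0 _) (@ratfun3_monom_inj k)).
Qed.
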